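(* Let $P=\{p_1,\dots,p_n\}$ be weighted points in $\mathbb{R}^2$ with total weight $1$, let $S=\{s_1,\dots,s_m\}$ be triangles in $\mathbb{R}^2$ of total area $1$ with longest edge length $\Delta$, and let $0<\delta\le\frac{1}{2\pi}$. Let $\tau$ be the transport plan produced by the construction described in the context and $\tau^*$ an optimal transport plan between $P$ and $S$. Then $\|\tau\|\le(1+9\delta)\|\tau^*\|$.
   Context: Each triangle's mass equals its area and is spread uniformly over it (all triangles have density one; overlapping triangles add densities). A transport plan from $P$ to $S$ moves from each $p$ its weight $\|p\|$ and delivers to the triangles exactly their mass distribution; its cost $\|\tau\|$ is the integral of (mass moved) times Euclidean distance; $\|\tau^*\|$ is the minimum cost (earth mover's distance). Construction: (1) Overlay a uniform grid of $\Delta\times\Delta$ square cells and keep the cells intersecting some triangle. (2) Recursively process each cell: if there is a point of $P$ such that the whole cell lies within Euclidean distance $\delta/\sqrt{nm}$ of it, stop; otherwise, if for some point of $P$ the ratio of the distances to the furthest and the closest point of the cell exceeds $1+\delta$, split the cell into four equal squares and recurse; otherwise stop. Let $Q$ be the resulting cells, each recording the total area of triangles within it. (3) In each cell $q\in Q$ pick an arbitrary point with weight equal to the total area of triangles contained in $q$; call this weighted set $T$. (4) Compute an optimal transport plan $\nu$ between $P$ and $T$. (5) Obtain $\tau$ by spreading the mass sent by $\nu$ to each $t\in T$ uniformly over the parts of the triangles lying in the cell from which $t$ was chosen. *)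

(* Defs.v *)
From HB Require Import structures.
From mathcomp Require Import all_boot all_order all_algebra.
From mathcomp Require Import all_classical all_reals all_analysis.
Set Implicit Arguments. Unset Strict Implicit. Unset Printing Implicit Defensive.
Import Order.TTheory GRing.Theory Num.Theory.
Local Open Scope classical_set_scope.
Local Open Scope ring_scope.

Section Defs.
Variable R : realType.

Definition pt2 := (R * R)%type.
Definition dist (x y : pt2) : R :=
  Num.sqrt ((x.1 - y.1) ^+ 2 + (x.2 - y.2) ^+ 2).

Definition leb2 := (@lebesgue_measure R \x @lebesgue_measure R)%E.

Definition triangle := (pt2 * pt2 * pt2)%type.
Definition tA (T : triangle) : pt2 := T.1.1.
Definition tB (T : triangle) : pt2 := T.1.2.
Definition tC (T : triangle) : pt2 := T.2.

Definition tri_set (T : triangle) : set pt2 :=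
  [set x | exists a b c : R, [/\ 0 <= a, 0 <= b, 0 <= c, a + b + c = 1 &
     x = (a * (tA T).1 + b * (tB T).1 + c * (tC T).1,
          a * (tA T).2 + b * (tB T).2 + c * (tC T).2)]].

Definition tri_area (T : triangle) : R :=
  `|((tB T).1 - (tA T).1) * ((tC T).2 - (tA T).2)
    - ((tB T).2 - (tA T).2) * ((tC T).1 - (tA T).1)| / 2.

Definition longest_edge (m : nat) (tri : 'I_m -> triangle) (D : R) : Prop :=
  (forall s, [/\ dist (tA (tri s)) (tB (tri s)) <= D,
                 dist (tB (tri s)) (tC (tri s)) <= D &
                 dist (tC (tri s)) (tA (tri s)) <= D]) /\
  (exists s, [\/ dist (tA (tri s)) (tB (tri s)) = D,
                 dist (tB (tri s)) (tC (tri s)) = D |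
                 dist (tC (tri s)) (tA (tri s)) = D]).

(** Mass density of the triangles: every triangle has density one,
    overlapping triangles add densities. *)
Definition rho (m : nat) (tri : 'I_m -> triangle) (x : pt2) : R :=
  \sum_(s < m) \1_(tri_set (tri s)) x.

(** Transport plans from the weighted points [P] (pt2 [p i] of weight
    [w i]) to the triangles.  A plan is given by the densities [f i] of the
    mass sent from [p i] (any plan is absolutely continuous since its second
    marginal is). *)
Definition is_plan (n m : nat) (w : 'I_n -> R) (tri : 'I_m -> triangle)
    (f : 'I_n -> pt2 -> R) : Prop :=
  [/\ (forall i, measurable_fun setT (f i)),
      (forall i x, 0 <= f i x),
      (forall i, (\int[leb2]_x (f i x)%:E = (w i)%:E)%E) &
      {ae leb2, forall x, \sum_(i < n) f i x = rho tri x}].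

Definition plan_cost (n : nat) (p : 'I_n -> pt2) (f : 'I_n -> pt2 -> R)
  : \bar R :=
  (\sum_(i < n) \int[leb2]_x (f i x * dist x (p i))%:E)%E.

(** Square cells: lower-left corner (cx, cy) and side cs. *)
Record cell := Cell { cx : R; cy : R; cs : R }.

(** half-open cell (the grid cells partition the plane) *)
Definition cell_set (c : cell) : set pt2 :=
  [set x | cx c <= x.1 < cx c + cs c /\ cy c <= x.2 < cy c + cs c].
(** closed cell (used for furthest / closest points) *)
Definition cell_cl (c : cell) : set pt2 :=
  [set x | cx c <= x.1 <= cx c + cs c /\ cy c <= x.2 <= cy c + cs c].

Definition grid_cell (o : pt2) (D : R) (i j : int) : cell :=
  Cell (o.1 + i%:~R * D) (o.2 + j%:~R * D) D.

Definition quadrant (c : cell) (b : bool * bool) : cell :=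
  Cell (cx c + (if b.1 then cs c / 2 else 0))
       (cy c + (if b.2 then cs c / 2 else 0)) (cs c / 2).

Section Subdivision.
Variables (n m : nat) (p : 'I_n -> pt2) (tri : 'I_m -> triangle)
          (delta : R) (o : pt2) (D : R).

Definition kept (c : cell) : Prop :=
  exists x, cell_set c x /\ exists s, tri_set (tri s) x.

Definition cell_near (c : cell) (q : pt2) : Prop :=
  forall z, cell_cl c z -> dist z q <= delta / Num.sqrt (n * m)%:R.

(** ratio of distances from q to the furthest and the closest pt2 of the
    cell exceeds 1 + delta (furthest/closest points exist as the closed cell
    is compact; the ratio is +infinity if the closest distance is 0). *)
Definition cell_ratio_big (c : cell) (q : pt2) : Prop :=
  exists z1 z2, [/\ cell_cl c z1, cell_cl c z2 &
                   (1 + delta) * dist z2 q < dist z1 q].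

Definition splits (c : cell) : Prop :=
  ~ (exists i, cell_near c (p i)) /\ (exists i, cell_ratio_big c (p i)).

Inductive reached : cell -> Prop :=
| reached_grid (i j : int) :
    kept (grid_cell o D i j) -> reached (grid_cell o D i j)
| reached_split (c : cell) (b : bool * bool) :
    reached c -> splits c -> reached (quadrant c b).

Definition leaf (c : cell) : Prop := reached c /\ ~ splits c.
End Subdivision.

Definition cell_mass (m : nat) (tri : 'I_m -> triangle) (c : cell) : R :=
  \sum_(s < m) fine (leb2 (tri_set (tri s) `&` cell_set c)).

Definition is_coupling (n k : nat) (w : 'I_n -> R) (a : 'I_k -> R)
    (nu : 'I_n -> 'I_k -> R) : Prop :=
  [/\ (forall i j, 0 <= nu i j),
      (forall i, \sum_(j < k) nu i j = w i) &
      (forall j, \sum_(i < n) nu i j = a j)].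

Definition disc_cost (n k : nat) (p : 'I_n -> pt2) (t : 'I_k -> pt2)
    (nu : 'I_n -> 'I_k -> R) : R :=
  \sum_(i < n) \sum_(j < k) nu i j * dist (p i) (t j).

(** step (5): the mass sent by nu from p i to t j is spread uniformly over
    the parts of the triangles lying in the cell of t j. *)
Definition spread_plan (n m k : nat) (tri : 'I_m -> triangle)
    (qc : 'I_k -> cell) (nu : 'I_n -> 'I_k -> R) : 'I_n -> pt2 -> R :=
  fun i x => \sum_(j < k)
     nu i j / cell_mass tri (qc j) * (rho tri x * \1_(cell_set (qc j)) x).

End Defs.

(* Main.v *)
(** Put [N = sqrt (n m)] and [r = delta / N].  For two points [x, y] of a
    leaf cell, [dist x p <= (1 + delta) * dist y p + e], where [e = 2 r] if
    the cell lies within [r] of some point of [P] and [e = 0] otherwise.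
    Hence moving the mass of a plan inside the cells costs a factor
    [1 + delta] plus an error [E], the sum of [e] times the mass over all
    cells.  Going from the optimal plan to its discretization, to [nu], and
    back to the triangles gives
    [|tau| <= (1 + delta) ((1 + delta) |tau*| + E) + E].

    The near cells are covered by [n] squares of side [2 r] and the density is
    at most [m], so [E <= 2 r * 4 n m r^2 = 8 delta^3 / N].  Likewise the [n]
    squares of side [2 s], [s = 1 / (4 N)], carry at most a quarter of the
    mass, so [|tau*| >= 3/4 s], and [E] is at most [128/3 delta^3 |tau*|].
    Squares in place of discs only lose a constant, and [pi >= 2], that is
    [delta <= 1/4], suffices to absorb everything in [9 delta]. *)
Require Import Defs.
From HB Require Import structures.
From mathcomp Require Import all_boot all_order all_algebra.
From mathcomp Require Import all_classical all_reals all_analysis.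
From mathcomp Require Import measurable_realfun ring lra.
Import Order.TTheory GRing.Theory Num.Theory numFieldNormedType.Exports.
Local Open Scope classical_set_scope.
Local Open Scope ring_scope.

(** * Integrals of nonnegative real-valued functions, and sums of indicators *)

Section RealValuedIntegrals.
Context d (T : measurableType d) (R : realType) (mu : {measure set T -> \bar R}).
Implicit Types (f g : T -> R) (c : R).
Local Notation I f := (\int[mu]_x (f x)%:E)%E.

Lemma integralE_ge0 f : (forall x, 0 <= f x) -> (0 <= I f)%E.
Proof. by move=> f0; apply: integral_ge0 => x _; rewrite lee_fin. Qed.

Lemma le_integralE f g : measurable_fun setT f -> measurable_fun setT g ->
  (forall x, 0 <= f x) -> (forall x, f x <= g x) -> (I f <= I g)%E.
Proof.
move=> mf mg f0 fg; apply: ge0_le_integral => //.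
- by move=> x _; rewrite lee_fin.
- exact/measurable_EFinP.
- exact/measurable_EFinP.
- by move=> x _; rewrite lee_fin.
Qed.

Lemma ae_le_integralE f g : measurable_fun setT f -> measurable_fun setT g ->
  (forall x, 0 <= f x) -> (forall x, 0 <= g x) ->
  {ae mu, forall x, f x <= g x} -> (I f <= I g)%E.
Proof.
move=> mf mg f0 g0 fg; apply: ae_ge0_le_integral => //.
- by move=> x _; rewrite lee_fin.
- exact/measurable_EFinP.
- by move=> x _; rewrite lee_fin.
- exact/measurable_EFinP.
- by apply: filterS fg => x fgx _; rewrite lee_fin.
Qed.

Lemma integralE_sum (J : finType) (P : pred J) (f : J -> T -> R) :
  (forall j, measurable_fun setT (f j)) -> (forall j x, 0 <= f j x) ->
  (\int[mu]_x (\sum_(j | P j) f j x)%:E = \sum_(j | P j) I (f j))%E.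
Proof.
move=> mf f0; under eq_integral do rewrite -sumEFin -big_filter.
rewrite -[RHS]big_filter.
apply: ge0_integral_sum => //.
- by move=> j; exact/measurable_EFinP.
- by move=> j x _; rewrite lee_fin.
Qed.

Lemma integralED f g : measurable_fun setT f -> measurable_fun setT g ->
  (forall x, 0 <= f x) -> (forall x, 0 <= g x) ->
  (\int[mu]_x (f x + g x)%:E = I f + I g)%E.
Proof.
move=> mf mg f0 g0; under eq_integral do rewrite EFinD.
apply: ge0_integralD => //.
- by move=> x _; rewrite lee_fin.
- exact/measurable_EFinP.
- by move=> x _; rewrite lee_fin.
- exact/measurable_EFinP.
Qed.

Lemma integralEZ c f : measurable_fun setT f -> (forall x, 0 <= f x) ->
  0 <= c -> (\int[mu]_x (c * f x)%:E = c%:E * I f)%E.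
Proof.
move=> mf f0 c0; under eq_integral do rewrite EFinM.
apply: ge0_integralZl => //.
- exact/measurable_EFinP.
- by move=> x _; rewrite lee_fin.
Qed.

Lemma integralE_indic A : measurable A ->
  (\int[mu]_x (\1_A x : R)%:E = mu A)%E.
Proof. by move=> mA; rewrite integral_indic// setIT. Qed.

End RealValuedIntegrals.

(** By disjointness the left side is 0 or 1, and it is 1 only at a point of some selected [C j],
    which some [B k] contains. *)
Lemma sum_indic_disjoint (T : Type) (R : realType) (J K : finType)
    (P : pred J) (C : J -> set T) (B : K -> set T) x :
  (forall i j y, C i y -> C j y -> i = j) ->
  (forall j, P j -> C j `<=` \bigcup_k B k) ->
  \sum_(j | P j) \1_(C j) x <= \sum_k \1_(B k) x :> R.
Proof.
move=> disjC CB; have ge0 k : 0 <= \1_(B k) x :> R by rewrite indicE ler0n.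
have [[j /andP[Pj /asboolP Cjx]]|noj] := pselect (exists j, P j && `[<C j x>]).
  have [k _ Bkx] := CB _ Pj _ Cjx.
  rewrite (bigD1 j)//= big1 ?addr0 => [|i /andP[_ ij]]; last first.
    rewrite indicE memNset// => Cix; move: ij.
    by rewrite (disjC _ _ _ Cix Cjx) eqxx.
  rewrite (bigD1 k)//= !indicE !mem_set// lerDl.
  by apply: sumr_ge0 => i _; exact: ge0.
rewrite big1 ?sumr_ge0// => j Pj; rewrite indicE memNset// => Cjx.
by apply: noj; exists j; rewrite Pj; exact/asboolP.
Qed.

(** * Passing between a plan with densities and a plan on cells *)

Section DiscretizedTransport.
Set Implicit Arguments.
Unset Strict Implicit.
Context d (T : measurableType d) (R : realType) (mu : {measure set T -> \bar R}).
Variables (n k : nat) (w : 'I_n -> R) (M : 'I_k -> R) (rho : T -> R).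
Variables (C : 'I_k -> set T) (g : 'I_n -> T -> R).
Variables (d0 : 'I_n -> 'I_k -> R) (a : R) (e : 'I_k -> R).
Hypothesis mrho : measurable_fun setT rho.
Hypothesis rho_ge0 : forall x, 0 <= rho x.
Hypothesis mC : forall j, measurable (C j).
Hypothesis mg : forall i, measurable_fun setT (g i).
Hypothesis g_ge0 : forall i x, 0 <= g i x.
Hypothesis d0_ge0 : forall i j, 0 <= d0 i j.
Hypothesis a_ge0 : 0 <= a.
Hypothesis e_ge0 : forall j, 0 <= e j.
Hypothesis massE : forall j, (\int[mu]_x (rho x * \1_(C j) x)%:E = (M j)%:E)%E.
(** Here [g i] stands for the distance to the [i]-th point and [d0 i j] for its value at the
    representative of cell [j]. The first inequality serves spreading the mass out, the second
    collecting it. *)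
Hypothesis g_le : forall i j x, C j x -> g i x <= a * d0 i j + e j.
Hypothesis g_ge : forall i j x, C j x -> d0 i j <= a * g i x + e j.

Let mass_ge0 j : 0 <= M j.
Proof.
rewrite -lee_fin -massE; apply: integralE_ge0 => x.
by rewrite mulr_ge0// indicE ler0n.
Qed.

Let m1 j : measurable_fun setT (\1_(C j) : T -> R).
Proof. exact: measurable_indic. Qed.

Let i_ge0 j x : 0 <= \1_(C j) x :> R.
Proof. by rewrite indicE ler0n. Qed.

(** On each cell [g i] is bounded by a constant, so the integral reduces to the mass [nu i j] times
    that constant. The column sums of [nu] then turn the errors [e j] into [e j * M j]. *)
Lemma spread_cost_le (nu : 'I_n -> 'I_k -> R) : is_coupling w M nu ->
  (\sum_i \int[mu]_x ((\sum_j nu i j / M j * (rho x * \1_(C j) x)) * g i x)%:E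
   <= (a * (\sum_i \sum_j nu i j * d0 i j) + \sum_j e j * M j)%:E)%E.
Proof.
move=> [nu0 nuw nuM].
pose b i j := a * d0 i j + e j.
have b0 i j : 0 <= b i j by rewrite addr_ge0// mulr_ge0.
have c0 i j : 0 <= nu i j / M j by rewrite divr_ge0.
have mr j : measurable_fun setT (fun x => rho x * \1_(C j) x).
  exact: measurable_funM.
have r0 j x : 0 <= rho x * \1_(C j) x by rewrite mulr_ge0.
(* In a cell of zero mass the quotient is 0 by convention; this is harmless, since the column sum
   [M j = 0] forces [nu i j = 0]. *)
have nuE i j : nu i j / M j * M j = nu i j.
  have [Mj0|Mj0] := eqVneq (M j) 0; last by rewrite divfK.
  rewrite Mj0 mulr0; apply/esym/eqP; rewrite eq_le nu0 andbT -Mj0 -nuM.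
  by rewrite (bigD1 i)//= lerDl sumr_ge0.
have -> : a * (\sum_i \sum_j nu i j * d0 i j) + \sum_j e j * M j =
          \sum_i \sum_j nu i j * b i j.
  under [X in _ = X]eq_bigr do under eq_bigr do rewrite mulrDr.
  under [X in _ = X]eq_bigr do rewrite big_split/=.
  rewrite big_split/=; congr (_ + _).
    rewrite mulr_sumr; apply: eq_bigr => i _; rewrite mulr_sumr.
    by apply: eq_bigr => j _; rewrite mulrCA.
  rewrite exchange_big/=; apply: eq_bigr => j _.
  by rewrite -mulr_suml nuM mulrC.
rewrite -sumEFin; apply: lee_sum => i _.
(* Writing the bound as an integral over the same cells makes the comparison pointwise. *)
have -> : ((\sum_j nu i j * b i j)%:E =
    \int[mu]_x (\sum_j (nu i j / M j * b i j) * (rho x * \1_(C j) x))%:E)%E.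
  rewrite integralE_sum; last 2 first.
  - by move=> j; apply: measurable_funM.
  - by move=> j x; rewrite mulr_ge0// mulr_ge0.
  rewrite -sumEFin; apply: eq_bigr => j _.
  rewrite integralEZ//; last by rewrite mulr_ge0.
  by rewrite massE -EFinM mulrAC nuE.
apply: le_integralE.
- apply: measurable_funM => //; apply: measurable_sum => j.
  exact: measurable_funM.
- by apply: measurable_sum => j; exact: measurable_funM.
- by move=> x; rewrite mulr_ge0// sumr_ge0// => j _; rewrite mulr_ge0.
- move=> x; rewrite mulr_suml ler_sum// => j _.
  have [Cjx|nCjx] := pselect (C j x).
    by rewrite mulrAC ler_wpM2r// ler_wpM2l// g_le.
  by rewrite indicE memNset// !(mulr0, mul0r).
Qed.

(* The cells need not be known to cover the support of the plan: the masses
   they receive add up to the full mass, so nothing is lost outside them. *)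
Lemma discretize_plan (f : 'I_n -> T -> R) :
  (forall i j x, C i x -> C j x -> i = j) ->
  \sum_j M j = \sum_i w i ->
  (forall i, measurable_fun setT (f i)) -> (forall i x, 0 <= f i x) ->
  (forall i, \int[mu]_x (f i x)%:E = (w i)%:E)%E ->
  {ae mu, forall x, \sum_i f i x = rho x} ->
  exists2 nu : 'I_n -> 'I_k -> R, is_coupling w M nu &
  ((\sum_i \sum_j nu i j * d0 i j)%:E
   <= a%:E * \sum_i \int[mu]_x (f i x * g i x)%:E
      + (\sum_j e j * M j)%:E)%E.
Proof.
move=> disjC Mw mf f0 fw frho.
have mfC i j : measurable_fun setT (fun x => f i x * \1_(C j) x).
  exact: measurable_funM.
have fC0 i j x : 0 <= f i x * \1_(C j) x by rewrite mulr_ge0.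
(* The domination of disjoint indicators, with the whole space as the only covering set. *)
have sum1 x : \sum_j \1_(C j) x <= 1 :> R.
  have := @sum_indic_disjoint T R 'I_k 'I_1 predT C (fun=> setT) x disjC.
  rewrite big_ord1 indicT; apply => j _ y _; by exists ord0.
(* The coupling collects the mass that [f i] puts into cell [j]. *)
pose nu i j := fine (\int[mu]_x (f i x * \1_(C j) x)%:E)%E.
have nuE i j : (\int[mu]_x (f i x * \1_(C j) x)%:E = (nu i j)%:E)%E.
  rewrite fineK// ge0_fin_numE ?integralE_ge0//.
  apply: (@le_lt_trans _ _ (w i)%:E); last by rewrite ltry.
  rewrite -fw; apply: le_integralE => // x.
  by rewrite ler_piMr// indicE lern1 leq_b1.
have nu0 i j : 0 <= nu i j by rewrite -lee_fin -nuE integralE_ge0.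
have nu_le i : \sum_j nu i j <= w i.
  rewrite -lee_fin -fw -sumEFin; under eq_bigr do rewrite -nuE.
  rewrite -integralE_sum//; apply: le_integralE => //.
  - exact: measurable_sum.
  - by move=> x; apply: sumr_ge0.
  - by move=> x; rewrite -mulr_sumr ler_piMr.
have nuM j : \sum_i nu i j = M j.
  apply/EFin_inj; rewrite -massE -sumEFin; under eq_bigr do rewrite -nuE.
  rewrite -integralE_sum//; apply: ge0_ae_eq_integral => //.
  - by apply/measurable_EFinP; exact: measurable_sum.
  - by apply/measurable_EFinP; exact: measurable_funM.
  - by move=> x _; rewrite lee_fin sumr_ge0.
  - by move=> x _; rewrite lee_fin mulr_ge0.
  - by apply: filterS frho => x fx _; rewrite -mulr_suml fx.
(* The deficits [w i - \sum_j nu i j] are nonnegative and add up to 0, so each of them vanishes. *)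
have nuw i : \sum_j nu i j = w i.
  have : \sum_i (w i - \sum_j nu i j) = 0.
    rewrite sumrB -Mw exchange_big/= (eq_bigr _ (fun j _ => nuM j)).
    by rewrite subrr.
  move/eqP; rewrite psumr_eq0 => [/allP/(_ i)|i' _]; last by rewrite subr_ge0.
  by rewrite mem_index_enum subr_eq0 => /(_ isT)/eqP.
exists nu => //.
have -> : \sum_j e j * M j = \sum_i \sum_j e j * nu i j.
  by rewrite exchange_big/=; apply: eq_bigr => j _; rewrite -mulr_sumr nuM.
have mfg i : measurable_fun setT (fun x => f i x * g i x).
  exact: measurable_funM.
rewrite ge0_sume_distrr => [|i _]; last first.
  by apply: integralE_ge0 => x; rewrite mulr_ge0.
rewrite -!sumEFin -big_split/=; apply: lee_sum => i _.
have fg0 x : 0 <= f i x * g i x by rewrite mulr_ge0.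
rewrite -integralEZ// -!sumEFin.
under eq_bigr do rewrite mulrC EFinM -nuE -integralEZ//.
under [X in (_ <= _ + X)%E]eq_bigr do rewrite EFinM -nuE -integralEZ//.
have mdC j : measurable_fun setT (fun x => d0 i j * (f i x * \1_(C j) x)).
  exact: measurable_funM.
have meC j : measurable_fun setT (fun x => e j * (f i x * \1_(C j) x)).
  exact: measurable_funM.
have dC0 j x : 0 <= d0 i j * (f i x * \1_(C j) x) by rewrite mulr_ge0.
have eC0 j x : 0 <= e j * (f i x * \1_(C j) x) by rewrite mulr_ge0.
rewrite -!integralE_sum// -integralED//; last 4 first.
- exact: measurable_funM.
- exact: measurable_sum.
- by move=> x; rewrite mulr_ge0.
- by move=> x; apply: sumr_ge0.
apply: le_integralE.
- exact: measurable_sum.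
- by apply: measurable_funD; [exact: measurable_funM|exact: measurable_sum].
- by move=> x; apply: sumr_ge0.
(* With the error moved to the left, each cell is compared separately through
   [d0 i j - e j <= a * g i x], and the indicators sum to at most 1. *)
move=> x; rewrite -lerBlDr -sumrB.
under eq_bigr do rewrite -mulrBl.
apply: (@le_trans _ _ (\sum_j a * (f i x * g i x) * \1_(C j) x)); last first.
  by rewrite -mulr_sumr ler_piMr// mulr_ge0.
apply: ler_sum => j _.
have [Cjx|nCjx] := pselect (C j x); last by rewrite indicE memNset// !mulr0.
rewrite [leLHS]mulrA ler_wpM2r// [leRHS]mulrCA [leLHS]mulrC ler_wpM2l//.
by rewrite lerBlDr g_ge.
Qed.

End DiscretizedTransport.

(** * Mass carried by small boxes, and a lower bound on the cost *)

Section MassBounds.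
Set Implicit Arguments.
Unset Strict Implicit.
Context d (T : measurableType d) (R : realType) (mu : {measure set T -> \bar R}).
Variables (n : nat) (rho : T -> R) (L v : R) (B : 'I_n -> set T).
Hypothesis mrho : measurable_fun setT rho.
Hypothesis rho_ge0 : forall x, 0 <= rho x.
Hypothesis rho_le : forall x, rho x <= L.
Hypothesis mB : forall i, measurable (B i).
Hypothesis muB : forall i, mu (B i) = v%:E.

Let i_ge0 (A : set T) x : 0 <= \1_A x :> R.
Proof. by rewrite indicE ler0n. Qed.

Let m1 i : measurable_fun setT (\1_(B i) : T -> R).
Proof. exact: measurable_indic. Qed.

(** Pointwise, [rho] is at most [L] and the indicators of the selected disjoint cells are dominated
    by those of the boxes, whose measures sum to [n * v]. *)
Lemma covered_mass_le k (M : 'I_k -> R) (C : 'I_k -> set T) (P : pred 'I_k) :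
  0 <= L -> (forall j, measurable (C j)) ->
  (forall i j x, C i x -> C j x -> i = j) ->
  (forall j, P j -> C j `<=` \bigcup_i B i) ->
  (forall j, (\int[mu]_x (rho x * \1_(C j) x)%:E = (M j)%:E)%E) ->
  \sum_(j | P j) M j <= L * (n%:R * v).
Proof.
move=> L0 mC disjC CB massE; rewrite -lee_fin -sumEFin.
have mr j : measurable_fun setT (fun x => rho x * \1_(C j) x).
  by apply: measurable_funM => //; exact: measurable_indic.
under eq_bigr do rewrite -massE.
rewrite -integralE_sum//; last by move=> j x; rewrite mulr_ge0.
have -> : L * (n%:R * v) = \sum_(i < n) (L * v).
  by rewrite sumr_const card_ord -mulr_natl; ring.
rewrite -sumEFin; under [X in (_ <= X)%E]eq_bigr => i _.
  rewrite EFinM -(muB i) -integralE_indic// -integralEZ//.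
  over.
rewrite -integralE_sum//; last first.
- by move=> i x; rewrite mulr_ge0.
- by move=> i; exact: measurable_funM.
apply: le_integralE.
- under eq_fun do rewrite big_mkcond.
  by apply: measurable_sum => j; case: (P j) => //; exact: measurable_cst.
- by apply: measurable_sum => i; exact: measurable_funM.
- by move=> x; apply: sumr_ge0 => j _; rewrite mulr_ge0.
move=> x; rewrite -!mulr_sumr.
apply: (@le_trans _ _ (L * \sum_(j | P j) \1_(C j) x)).
  by rewrite ler_wpM2r// sumr_ge0.
by rewrite ler_wpM2l//; exact: sum_indic_disjoint.
Qed.

(** Mass of [f i] outside [B i] costs at least [s] per unit. Inside, [f i <= rho <= L] almost
    everywhere, so at most [L * v] escapes this bound. *)
Lemma plan_cost_ge (w : 'I_n -> R) (f g : 'I_n -> T -> R) (s : R) :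
  0 <= L -> 0 <= s ->
  (forall i, measurable_fun setT (f i)) -> (forall i x, 0 <= f i x) ->
  (forall i, measurable_fun setT (g i)) -> (forall i x, 0 <= g i x) ->
  (forall i, \int[mu]_x (f i x)%:E = (w i)%:E)%E ->
  {ae mu, forall x, \sum_i f i x = rho x} ->
  (forall i x, ~ B i x -> s <= g i x) ->
  ((s * (\sum_i w i))%:E <=
   \sum_i \int[mu]_x (f i x * g i x)%:E + (s * (L * (n%:R * v)))%:E)%E.
Proof.
move=> L0 s0 mf f0 mg g0 fw frho sg.
have -> : s * (L * (n%:R * v)) = \sum_(i < n) (s * L * v).
  by rewrite sumr_const card_ord -mulr_natl; ring.
rewrite mulr_sumr -!sumEFin -big_split/=; apply: lee_sum => i _.
have mfg : measurable_fun setT (fun x => f i x * g i x).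
  exact: measurable_funM.
have fg0 x : 0 <= f i x * g i x by rewrite mulr_ge0.
have mfB : measurable_fun setT (fun x => s * L * \1_(B i) x).
  exact: measurable_funM.
have fB0 x : 0 <= s * L * \1_(B i) x by rewrite mulr_ge0// mulr_ge0.
rewrite EFinM [X in (_ <= _ + X)%E]EFinM -fw -(muB i) -integralE_indic//.
rewrite -!integralEZ// -?integralED//; last by rewrite mulr_ge0.
apply: ae_le_integralE.
- exact: measurable_funM.
- exact: measurable_funD.
- by move=> x; rewrite mulr_ge0.
- by move=> x; rewrite addr_ge0.
apply: filterS frho => x fx.
have [Bx|nBx] := pselect (B i x).
  rewrite indicE mem_set// mulr1 -[leLHS]add0r lerD// ler_wpM2l//.
  apply: le_trans (rho_le x); rewrite -fx (bigD1 i)//= lerDl.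
  by apply: sumr_ge0.
by rewrite indicE memNset// mulr0 addr0 mulrC ler_wpM2l// sg.
Qed.

End MassBounds.

(** * Measurable sets and Euclidean distance in the plane *)

Section PlaneMeasurability.
Set Implicit Arguments.
Unset Strict Implicit.
Variable R : realType.
Local Notation plane := (measurableTypeR R * measurableTypeR R)%type.

(** An open set is the union of the squares with rational centre and radius that it contains: a
    countable union of measurable rectangles. *)
Lemma open_measurable_plane (U : set (R * R)) : open U ->
  measurable (U : set plane).
Proof.
move=> oU.
pose Q := (rat * rat * rat)%type.
pose F (q : Q) : set (R * R) :=
  ball (ratr q.1.1 : R) (ratr q.2) `*` ball (ratr q.1.2 : R) (ratr q.2).
pose G q := if `[<F q `<=` U>] then F q else set0.
have -> : U = \bigcup_q G q.
  apply/seteqP; split=> [x Ux|x [q _]]; last first.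
    by rewrite /G; case: ifPn => // /asboolP; exact.
  have /nbhs_ballP[e /= e0 xeU] : nbhs x U by exact: open_nbhs_nbhs.
  (* A point of the rational square is reached from [x] through its centre, at a distance below
     [2 * r < e] in each coordinate. *)
  have [r] := @rat_in_itvoo R 0 (e / 2) (divr_gt0 e0 (ltr0n _ 2)).
  rewrite in_itv/= => /andP[r0 re].
  have appr (y : R) : exists q : rat, `|ratr q - y| < ratr r.
    have [|q] := @rat_in_itvoo R (y - ratr r) (y + ratr r); first by lra.
    by rewrite in_itv/= => qy; exists q; rewrite ltr_distl.
  have [[a xa] [b xb]] := (appr x.1, appr x.2).
  exists (a, b, r) => //; rewrite /G ifT; first by split.
  apply/asboolP => y [/= ya yb]; apply: xeU; split; rewrite /ball/=.
  - rewrite (_ : x.1 - y.1 = (ratr a - y.1) - (ratr a - x.1)); last by ring.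
    rewrite (le_lt_trans (ler_normB _ _))//.
    by move: ya; rewrite /ball/= => ya; lra.
  - rewrite (_ : x.2 - y.2 = (ratr b - y.2) - (ratr b - x.2)); last by ring.
    rewrite (le_lt_trans (ler_normB _ _))//.
    by move: yb; rewrite /ball/= => yb; lra.
apply: countable_bigcupT_measurable => [|q]; first exact: countableP.
rewrite /G; case: ifP => _ //.
by apply: measurableX; exact: measurable_ball.
Qed.

Lemma closed_measurable_plane (F : set (R * R)) : closed F ->
  measurable (F : set plane).
Proof.
move=> /closed_openC/open_measurable_plane mF.
by rewrite -[F]setCK; exact: measurableC.
Qed.

(* The unit square is mapped onto the triangle by [(u, v) |-> (1 - u) A +
   u (1 - v) B + u v C], which exhibits the triangle as a compact set. *)
Lemma tri_set_image (A : triangle R) :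
  tri_set A = (fun z : R * R =>
    ((1 - z.1) * (tA A).1 + z.1 * (1 - z.2) * (tB A).1 + z.1 * z.2 * (tC A).1,
     (1 - z.1) * (tA A).2 + z.1 * (1 - z.2) * (tB A).2 + z.1 * z.2 * (tC A).2))
  @` (`[0, 1] `*` `[0, 1]).
Proof.
apply/seteqP; split=> [x [a [b [c [a0 b0 c0 abc ->]]]]|x [[u v] /=]].
  (* At the vertex [tA A] one has [b + c = 0]; the second parameter is then 0 by convention, and any
     value in the unit interval would do. *)
  exists (b + c, c / (b + c)) => /=.
    rewrite !in_itv/=; split; first by apply/andP; lra.
    rewrite divr_ge0 ?addr_ge0//=; have [->|bc] := eqVneq (b + c) 0.
      by rewrite invr0 mulr0.
    by rewrite ler_pdivrMr ?mul1r ?lerDr// lt0r bc addr_ge0.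
  have -> : (b + c) * (c / (b + c)) = c.
    have [bc|bc] := eqVneq (b + c) 0; last by rewrite mulrC divfK.
    by rewrite bc mul0r; lra.
  have -> : (b + c) * (1 - c / (b + c)) = b.
    have [bc|bc] := eqVneq (b + c) 0; first by rewrite bc mul0r; lra.
    by rewrite mulrBr mulr1 [X in _ - X]mulrC divfK// addrK.
  by have -> : 1 - (b + c) = a by lra.
rewrite !in_itv/= => -[/andP[u0 u1] /andP[v0 v1]] <-.
exists (1 - u), (u * (1 - v)), (u * v); split=> //.
- by lra.
- by rewrite mulr_ge0//; lra.
- by rewrite mulr_ge0.
- by ring.
Qed.

Lemma measurable_tri_set (A : triangle R) : measurable (tri_set A : set plane).
Proof.
apply: closed_measurable_plane; rewrite tri_set_image.
apply: compact_closed; first exact: norm_hausdorff.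
apply: continuous_compact; last by apply: compact_setX; exact: segment_compact.
apply: continuous_subspaceT => z.
have c1 : {for z, continuous (fst : R * R -> R)} by exact: cvg_fst.
have c2 : {for z, continuous (snd : R * R -> R)} by exact: cvg_snd.
have cc (r : R) : {for z, continuous (fun=> r : R)} by exact: cvg_cst.
have cont a b c : {for z, continuous (fun y : R * R =>
    (1 - y.1) * a + y.1 * (1 - y.2) * b + y.1 * y.2 * c)}.
  exact: (cvgD (cvgD (cvgM (cvgB (cc 1) c1) (cc a))
    (cvgM (cvgM c1 (cvgB (cc 1) c2)) (cc b))) (cvgM (cvgM c1 c2) (cc c))).
exact: (cvg_pair (cont _ _ _) (cont _ _ _)).
Qed.

Lemma measurable_cell_set (c : cell R) : measurable (cell_set c : set plane).
Proof.
rewrite (_ : cell_set c = `[cx c, cx c + cs c[ `*` `[cy c, cy c + cs c[).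
  by apply: measurableX; exact: measurable_itv.
by apply/seteqP; split=> x /=; rewrite !in_itv/=.
Qed.

Lemma measurable_dist (q : R * R) :
  measurable_fun setT (fun x : plane => dist x q).
Proof.
apply: (measurableT_comp (continuous_measurable_fun (@sqrt_continuous R))).
apply: measurable_funD; apply: measurable_funX; apply: measurable_funB => //.
Qed.

(** A square containing the disc of radius [r]; its area is directly a product of two lengths. *)
Definition sq_box (q : R * R) (r : R) : set (R * R) :=
  `[q.1 - r, q.1 + r] `*` `[q.2 - r, q.2 + r].

Lemma measurable_sq_box q r : measurable (sq_box q r : set plane).
Proof. by apply: measurableX; exact: measurable_itv. Qed.

Lemma leb2_sq_box q r : 0 < r -> leb2 (sq_box q r) = (4 * r ^+ 2)%:E.
Proof.
move=> r0; rewrite /leb2 product_measure1E; [|exact: measurable_itv..].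
have len y : lebesgue_measure `[y - r, y + r] = (2 * r)%:E.
  rewrite lebesgue_measure_itv/= lte_fin ifT; last by lra.
  by rewrite -EFinB; congr EFin; lra.
rewrite (_ : 4 * r ^+ 2 = (2 * r) * (2 * r)); last by ring.
by rewrite EFinM; congr (_ * _)%E; exact: len.
Qed.

Lemma sq_boxP q r x : sq_box q r x <-> `|x.1 - q.1| <= r /\ `|x.2 - q.2| <= r.
Proof. by rewrite /sq_box/= !in_itv/= !ler_distl. Qed.

Lemma dist_ge_coord (x q : R * R) : `|x.1 - q.1| <= dist x q /\ `|x.2 - q.2| <= dist x q.
Proof.
by rewrite /dist -!sqrtr_sqr; split; apply: ler_wsqrtr;
  rewrite ?lerDl ?lerDr sqr_ge0.
Qed.

Lemma sq_box_dist q r x : dist x q <= r -> sq_box q r x.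
Proof.
move=> xq; apply/sq_boxP; have [h1 h2] := dist_ge_coord x q.
by rewrite !(le_trans _ xq).
Qed.

Lemma dist_sq_boxC q r x : ~ sq_box q r x -> r <= dist x q.
Proof. by move=> xq; rewrite leNgt; apply/negP => /ltW/sq_box_dist. Qed.

Lemma dist_ge0 (x y : R * R) : 0 <= dist x y.
Proof. exact: sqrtr_ge0. Qed.

Lemma distC (x y : R * R) : dist x y = dist y x.
Proof. by rewrite /dist -(sqrrN (x.1 - _)) -(sqrrN (x.2 - _)) !opprB. Qed.

Lemma dist_triangle (x y z : R * R) : dist x z <= dist x y + dist y z.
Proof.
rewrite /dist.
set a := x.1 - y.1; set b := x.2 - y.2; set c := y.1 - z.1; set d := y.2 - z.2.
have -> : x.1 - z.1 = a + c by rewrite /a /c; ring.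
have -> : x.2 - z.2 = b + d by rewrite /b /d; ring.
have ab : 0 <= a ^+ 2 + b ^+ 2 by rewrite addr_ge0// sqr_ge0.
have cd : 0 <= c ^+ 2 + d ^+ 2 by rewrite addr_ge0// sqr_ge0.
have s0 : 0 <= Num.sqrt (a ^+ 2 + b ^+ 2) + Num.sqrt (c ^+ 2 + d ^+ 2).
  by rewrite addr_ge0// sqrtr_ge0.
rewrite -[leRHS]ger0_norm// -sqrtr_sqr ler_wsqrtr// [leRHS]sqrrD !sqr_sqrtr//.
(* Cauchy-Schwarz in the plane, from Lagrange's identity with remainder [(a * d - b * c) ^+ 2]. *)
have CS : a * c + b * d <= Num.sqrt (a ^+ 2 + b ^+ 2) * Num.sqrt (c ^+ 2 + d ^+ 2).
  rewrite -sqrtrM// (le_trans (ler_norm _))// -sqrtr_sqr ler_wsqrtr//.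
  have : 0 <= (a * d - b * c) ^+ 2 by exact: sqr_ge0.
  by nra.
by nra.
Qed.

End PlaneMeasurability.

(** * Disjointness of the leaves of the quadtree *)

Section Quadtree.
Set Implicit Arguments.
Unset Strict Implicit.
Variables (R : realType) (n m : nat) (p : 'I_n -> R * R)
  (tri : 'I_m -> triangle R) (delta : R) (o : R * R) (D : R).
Hypothesis D_gt0 : 0 < D.

(** The dyadic cells of level [l]. Their explicit coordinates allow reached cells to be compared
    through levels and integer indices. *)
Definition aligned_cell (l : nat) (i j : int) : cell R :=
  Cell (o.1 + i%:~R * (D / 2 ^+ l)) (o.2 + j%:~R * (D / 2 ^+ l)) (D / 2 ^+ l).

Lemma reached_aligned c : reached p tri delta o D c ->
  exists l i j, c = aligned_cell l i j.
Proof.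
elim=> [i j _|{}c b _ [l [i [j ->]]] _].
  by exists 0%N, i, j; rewrite /aligned_cell expr0 divr1.
(* The two bits of [b] become the last binary digits of the new indices. *)
exists l.+1, (2 * i + b.1%:Z), (2 * j + b.2%:Z).
have half (z : int) (e : bool) (s : R) :
    (2 * z + e%:Z)%:~R * (s / 2) = z%:~R * s + (if e then s / 2 else 0).
  by rewrite rmorphD rmorphM rmorph_nat/=; case: e; rewrite ?mulr1z ?mulr0z; field.
have s2 : D / 2 ^+ l.+1 = (D / 2 ^+ l) / 2.
  by rewrite exprS invfM; ring.
by rewrite /quadrant [in RHS]/aligned_cell s2 !half !addrA.
Qed.

(** In each coordinate, two half-open intervals sharing a point have indices that differ by less
    than 1, hence equal integers. *)
Lemma aligned_cell_inj l i j i' j' x :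
  cell_set (aligned_cell l i j) x -> cell_set (aligned_cell l i' j') x ->
  aligned_cell l i j = aligned_cell l i' j'.
Proof.
have s0 : 0 < D / 2 ^+ l by rewrite divr_gt0// exprn_gt0.
have uniq (a y : R) (u v : int) : let s := D / 2 ^+ l in
    a + u%:~R * s <= y < a + u%:~R * s + s ->
    a + v%:~R * s <= y < a + v%:~R * s + s -> u = v.
  move=> s /andP[h1 h2] /andP[h3 h4].
  have ineq (w z : int) : w%:~R * s < z%:~R * s + s -> w <= z.
    rewrite -[X in _ + X]mul1r -mulrDl ltr_pM2r//.
    rewrite (_ : z%:~R + 1 = (z + 1)%:~R); last by rewrite rmorphD.
    by rewrite ltr_int ltzD1.
  by apply/eqP; rewrite eq_le !ineq//; lra.
move=> [/= x1 x2] [/= x1' x2'].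
by rewrite (uniq _ _ _ _ x1 x1') (uniq _ _ _ _ x2 x2').
Qed.

Lemma cell_set_quadrant (c : cell R) b : 0 <= cs c ->
  cell_set (quadrant c b) `<=` cell_set c.
Proof.
case: c b => a b s [b1 b2] /= s0 x [/=].
move=> /andP[h1 h2] /andP[h3 h4]; split; apply/andP; split;
  case: b1 b2 h1 h2 h3 h4 => [] [] /= *; lra.
Qed.

(** Overlapping dyadic cells are nested, so the chain of ancestors of the smaller cell [c'] passes
    through [c]: either [c] is [c'] or it was split on the way. The proof is by induction on the
    derivation of [c']. *)
Lemma reached_overlap c c' x :
  reached p tri delta o D c -> reached p tri delta o D c' ->
  cs c' <= cs c -> cell_set c x -> cell_set c' x ->
  c' = c \/ splits m p delta c.
Proof.
move=> rc rc'; have [l [i [j cE]]] := reached_aligned rc.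
(* Sides are [D] over powers of two, so a side at most that of [c] and more than half of it has the
   level of [c]. *)
have same l' i' j' : cs (aligned_cell l' i' j') <= cs c -> 
    cs c < 2 * cs (aligned_cell l' i' j') -> l' = l.
  rewrite cE /= !ler_pM2l// mulrCA ltr_pM2l//.
  rewrite lef_pV2 ?posrE ?exprn_gt0// ler_eXn2l ?ltr1n// => ll'.
  have [->//|ne] := eqVneq l' l.
  have {ne} : (l < l')%N by rewrite ltn_neqAle eq_sym ne.
  move=> /subnKC <-; rewrite addSn exprS invfM mulrA divff ?pnatr_eq0// mul1r.
  rewrite ltf_pV2 ?posrE ?exprn_gt0// ltr_eXn2l ?ltr1n// => h.
  by move: h; rewrite ltnNge leq_addr.
elim: rc' => [i' j' _|{}c' b rc' IH sc'].
  have -> : grid_cell o D i' j' = aligned_cell 0 i' j'.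
    by rewrite /aligned_cell expr0 divr1.
  move=> le_cs cx cx'; left; have l0 : 0%N = l.
    apply: (same _ i' j') => //; rewrite cE /= expr0 divr1.
    apply: (@le_lt_trans _ _ D); last by rewrite ltr_pMl ?ltr1n.
    by rewrite ler_pdivrMr ?exprn_gt0// ler_peMr ?exprn_ege1 ?ler1n// ltW.
  by move: cx cx'; rewrite cE -l0 => cx cx'; exact: aligned_cell_inj cx' cx.
have [l' [i' [j' qE]]] :=
  reached_aligned (reached_split b rc' sc').
move=> le_cs cx cx'.
have c'0 : 0 < cs c'.
  by have [? [? [? ->]]] := reached_aligned rc'; rewrite divr_gt0// exprn_gt0.
(* If the parent [c'] is no larger than [c], induction applies, and a parent equal to [c] shows that
   [c] splits. If it is larger, its quadrant has the level of [c]. *)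
have [le2|lt2] := leP (cs c') (cs c).
  have [] := IH le2 cx (cell_set_quadrant (ltW c'0) cx'); last by right.
  by move=> <-; right.
left; move: cx cx' le_cs; rewrite qE => cx cx' le_cs.
have ll' : l' = l.
  apply: same le_cs _; rewrite -qE /= mulrC divfK//.
by move: cx cx'; rewrite ll' cE => cx cx'; exact: aligned_cell_inj cx' cx.
Qed.

Lemma leaf_disjoint c c' x :
  leaf p tri delta o D c -> leaf p tri delta o D c' ->
  cell_set c x -> cell_set c' x -> c = c'.
Proof.
move=> [rc sc] [rc' sc'] cx cx'; have [le|/ltW le] := leP (cs c') (cs c).
- by have [] := reached_overlap rc rc' le cx cx'.
- by have [] := reached_overlap rc' rc le cx' cx.
Qed.

End Quadtree.

(** * Variation of the distance to a point of [P] within a leaf *)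

Section LeafDistances.
Set Implicit Arguments.
Unset Strict Implicit.
Variables (R : realType) (n m : nat) (p : 'I_n -> R * R)
  (tri : 'I_m -> triangle R) (delta : R) (o : R * R) (D : R).

Definition near_cell (c : cell R) : bool :=
  `[< exists i, cell_near n m delta c (p i) >].

Lemma cell_set_cl (c : cell R) : cell_set c `<=` cell_cl c.
Proof.
by move=> x [/andP[x1 x2] /andP[x3 x4]]; split; rewrite ?x1 ?x3 ltW.
Qed.

(** In a near cell, [x] and [y] are both close to some [p i0], possibly other than [p i], and the
    triangle inequality is used twice. In any other leaf, a violation would be a large ratio and the
    cell would split. *)
Lemma leaf_dist_le c x y i : 0 <= delta ->
  leaf p tri delta o D c -> cell_set c x -> cell_set c y ->
  dist x (p i) <= (1 + delta) * dist y (p i) +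
    (if near_cell c then 2 * (delta / Num.sqrt (n * m)%:R) else 0).
Proof.
move=> d0 [_ nsplit] /cell_set_cl cx /cell_set_cl cy.
have y0 : 0 <= delta * dist y (p i) by rewrite mulr_ge0// dist_ge0.
rewrite /near_cell; case: ifPn => [/asboolP[i0 near]|/asboolP far].
  have := near _ cx; have := near _ cy.
  have := dist_triangle x y (p i); have := dist_triangle x (p i0) y.
  by rewrite (distC (p i0) y); lra.
rewrite addr0 leNgt; apply/negP => big; apply: nsplit; split => //.
by exists i; exists x, y.
Qed.

End LeafDistances.

(** * The mass density of the triangles *)

Section TriangleMass.
Set Implicit Arguments.
Unset Strict Implicit.
Variables (R : realType) (m : nat) (tri : 'I_m -> triangle R).
Local Notation plane := (measurableTypeR R * measurableTypeR R)%type.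

Lemma rho_ge0 x : 0 <= rho tri x.
Proof. by apply: sumr_ge0 => s _; rewrite indicE ler0n. Qed.

Lemma rho_le x : rho tri x <= m%:R.
Proof.
rewrite -[m in leRHS]card_ord -sum1_card natr_sum; apply: ler_sum => s _.
by rewrite indicE ler_nat leq_b1.
Qed.

Lemma measurable_rho : measurable_fun setT (rho tri : plane -> R).
Proof.
apply: measurable_sum => s; apply: measurable_indic.
exact: measurable_tri_set.
Qed.

(** A bounded cell meets each triangle in finite measure, so [fine] loses nothing in [cell_mass]. *)
Lemma cell_massE (c : cell R) :
  (\int[leb2 (R:=R)]_x (rho tri x * \1_(cell_set c) x)%:E =
   (cell_mass tri c)%:E)%E.
Proof.
have mtc s : measurable (tri_set (tri s) `&` cell_set c : set plane).
  by apply: measurableI; [exact: measurable_tri_set|exact: measurable_cell_set].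
have fin s : leb2 (tri_set (tri s) `&` cell_set c) \is a fin_num.
  (* This radius is positive whatever the sign of the side of [c]. *)
  have r0 : 0 < `|cs c| + 1 by rewrite ltr_wpDl.
  rewrite ge0_fin_numE; last exact: measure_ge0.
  apply: (@le_lt_trans _ _ (leb2 (sq_box (cx c, cy c) (`|cs c| + 1)))); last first.
    by rewrite leb2_sq_box// ltry.
  apply: le_measure; rewrite ?inE//; first exact: measurable_sq_box.
  move=> x [_ [/andP[x1 x2] /andP[x3 x4]]]; apply/sq_boxP => /=.
  by have := ler_norm (cs c); rewrite !ger0_norm; lra.
have indE s : (\int[leb2 (R:=R)]_x (\1_(tri_set (tri s) `&` cell_set c) x : R)%:E
    = (fine (leb2 (tri_set (tri s) `&` cell_set c)))%:E)%E.
  by rewrite fineK//; exact: integralE_indic.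
rewrite /cell_mass -sumEFin; under [RHS]eq_bigr do rewrite -indE.
rewrite -integralE_sum//; last by move=> s; exact: measurable_indic.
apply: eq_integral => x _; rewrite /rho mulr_suml; congr EFin.
by apply: eq_bigr => s _; rewrite indicI.
Qed.

(** Otherwise every triangle would collapse to a point and the total area would be 0. *)
Lemma longest_edge_gt0 D : longest_edge tri D ->
  \sum_(s < m) tri_area (tri s) = 1 -> 0 < D.
Proof.
move=> [edge _] area; rewrite ltNge; apply/negP => D0.
have dist0 (x y : R * R) : dist x y <= D -> x = y.
  move=> xyD; have [h1 h2] := dist_ge_coord x y.
  have zero (u : R) : `|u| <= dist x y -> u = 0.
    move=> h; apply/eqP; rewrite -normr_eq0 eq_le normr_ge0 andbT.
    by rewrite (le_trans h)// (le_trans xyD).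
  rewrite [x]surjective_pairing [y]surjective_pairing; congr pair.
    by apply/eqP; rewrite -subr_eq0 (zero _ h1).
  by apply/eqP; rewrite -subr_eq0 (zero _ h2).
move: area; rewrite big1 => [/esym/eqP|s _]; first by rewrite oner_eq0.
have [/dist0 AB _ /dist0 CA] := edge s.
by rewrite /tri_area CA AB !subrr normr0 mul0r.
Qed.

End TriangleMass.

(** * Final constants and assembly of the bound *)

Lemma approximation_ratio (R : realFieldType) (delta c N E disc' disc spread : R) :
  0 < delta -> delta <= 1 / 4 -> 0 < N ->
  E <= 8 * delta ^+ 3 / N -> 3 / (16 * N) <= c ->
  spread <= (1 + delta) * disc + E -> disc <= disc' ->
  disc' <= (1 + delta) * c + E ->
  spread <= (1 + 9 * delta) * c.
Proof.
move=> d0 d4 N0 EN cN h1 h2 h3.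
have {}EN : E <= 128 / 3 * delta ^+ 3 * c.
  apply: (le_trans EN).
  (* The constant [128 / 3] is [8] divided by [3 / 16], so that [1 / N] can be traded for [c]. *)
  have -> : 8 * delta ^+ 3 / N = 128 / 3 * delta ^+ 3 * (3 / (16 * N)).
    by field; rewrite gt_eqF.
  by rewrite ler_wpM2l// mulr_ge0// exprn_ge0// ltW.
have c0 : 0 <= c by apply: le_trans cN; rewrite divr_ge0// mulr_ge0// ltW.
have : spread <= (1 + delta) * ((1 + delta) * c + E) + E.
  by apply: (le_trans h1); rewrite lerD2r ler_wpM2l ?(le_trans h2)//; lra.
have : (2 + delta) * E <= (2 + delta) * (128 / 3 * delta ^+ 3 * c).
  by rewrite ler_wpM2l//; lra.
(* This is what remains of [(1 + 9 * delta) * c] after subtracting [(1 + delta) ^+ 2 * c] and the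
   bound on [(2 + delta) * E]. For [delta <= 1 / 4] the last term is at most
   [128 / 3 * (9 / 64) = 6], so the bracket is at least [3 / 4]. *)
have : 0 <= c * delta * (7 - delta - 128 / 3 * delta ^+ 2 * (2 + delta)).
  rewrite !mulr_ge0 ?(ltW d0)//.
  have : delta ^+ 2 * (2 + delta) <= (1 / 16) * (9 / 4).
    apply: ler_pM; rewrite ?exprn_ge0//; [exact: ltW|lra|nra|lra].
  by rewrite -mulrA; lra.
by rewrite !exprSr expr0; lra.
Qed.

Theorem theorem4 (R : realType) (n m k : nat)
  (w : 'I_n -> R) (p : 'I_n -> pt2 R) (tri : 'I_m -> triangle R)
  (D delta : R) (o : pt2 R)
  (qc : 'I_k -> cell R) (t : 'I_k -> pt2 R)
  (nu : 'I_n -> 'I_k -> R) (tau_opt : 'I_n -> pt2 R -> R) :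
  (forall i, 0 < w i) -> \sum_(i < n) w i = 1 ->
  \sum_(s < m) tri_area (tri s) = 1 -> longest_edge tri D ->
  0 < delta -> delta <= 1 / (2 * pi) ->
  (* Q = the cells produced by steps (1)-(2), enumerated without repetition *)
  injective qc ->
  (forall c, (exists j, qc j = c) <-> leaf p tri delta o D c) ->
  (* step (3): an arbitrary pt2 of each cell *)
  (forall j, cell_set (qc j) (t j)) ->
  (* step (4): nu is an optimal transport plan between P and T *)
  is_coupling w (fun j => cell_mass tri (qc j)) nu ->
  (forall nu', is_coupling w (fun j => cell_mass tri (qc j)) nu' ->
     disc_cost p t nu <= disc_cost p t nu') ->
  (* tau_opt is an optimal transport plan between P and S *)
  is_plan w tri tau_opt ->
  (forall sigma, is_plan w tri sigma ->
     (plan_cost p tau_opt <= plan_cost p sigma)%E) ->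
  (plan_cost p (spread_plan tri qc nu)
     <= (1 + 9 * delta)%:E * plan_cost p tau_opt)%E.
Proof.
move=> _ w1 area edge d0 dpi qc_inj leafP tqc coup nu_opt plan _.
have D0 := longest_edge_gt0 edge area.
have [mf0 f0 fw frho] := plan.
have mf i : measurable_fun setT
  (tau_opt i : measurableTypeR R * measurableTypeR R -> R) by exact: mf0.
have d4 : delta <= 1 / 4.
  apply: (le_trans dpi); rewrite !mul1r lef_pV2 ?posrE ?mulr_gt0 ?pi_gt0//.
  by have := pi_ge2 R; lra.
have n0 : (0 < n)%N.
  rewrite lt0n; apply/eqP => n0; move: w1; subst n.
  by rewrite big_ord0 => /esym/eqP; rewrite oner_eq0.
have m0 : (0 < m)%N.
  rewrite lt0n; apply/eqP => m0; move: area; subst m.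
  by rewrite big_ord0 => /esym/eqP; rewrite oner_eq0.
pose N : R := Num.sqrt (n * m)%:R.
have N2 : m%:R * n%:R = N ^+ 2 :> R.
  by rewrite sqr_sqrtr ?ler0n// -natrM mulnC.
have N0 : 0 < N by rewrite sqrtr_gt0 ltr0n muln_gt0 n0.
have Nn0 : N != 0 by rewrite lt0r_neq0.
pose r := delta / N.
have r0 : 0 < r by rewrite divr_gt0.
pose near j := near_cell m p delta (qc j).
pose e j : R := if near j then 2 * r else 0.
pose M j := cell_mass tri (qc j).
pose g i x : R := dist x (p i).
have e0 j : 0 <= e j by rewrite /e; case: ifP => // _; rewrite mulr_ge0// ltW.
have leaf_qc j : leaf p tri delta o D (qc j) by apply/leafP; exists j.
have disj i j x : cell_set (qc i) x -> cell_set (qc j) x -> i = j.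
  by move=> ci cj; apply/qc_inj/(leaf_disjoint D0 (leaf_qc i) (leaf_qc j) ci cj).
have mC j := measurable_cell_set (qc j).
have massE j := cell_massE tri (qc j).
have mg i := measurable_dist (p i).
have g0 i x : 0 <= g i x by exact: dist_ge0.
have dd0 i j : 0 <= dist (p i) (t j) by exact: dist_ge0.
have a0 : 0 <= 1 + delta by lra.
have g_le i j x : cell_set (qc j) x ->
    g i x <= (1 + delta) * dist (p i) (t j) + e j.
  move=> cx; rewrite (distC (p i)).
  exact: (leaf_dist_le i (ltW d0) (leaf_qc j) cx (tqc j)).
have g_ge i j x : cell_set (qc j) x ->
    dist (p i) (t j) <= (1 + delta) * g i x + e j.
  move=> cx; rewrite (distC (p i)).
  exact: (leaf_dist_le i (ltW d0) (leaf_qc j) (tqc j) cx).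
have EN : \sum_j e j * M j <= 8 * delta ^+ 3 / N.
  have -> : \sum_j e j * M j = 2 * r * \sum_(j | near j) M j.
    rewrite mulr_sumr [RHS]big_mkcond/=; apply: eq_bigr => j _.
    by rewrite /e; case: ifP => // _; rewrite mul0r.
  have -> : 8 * delta ^+ 3 / N = 2 * r * (m%:R * (n%:R * (4 * r ^+ 2))).
    by rewrite [X in _ = _ * X]mulrA N2 /r; field; rewrite gt_eqF.
  rewrite ler_wpM2l ?(mulr_ge0 _ (ltW r0))//.
  have near_sub j : near j -> cell_set (qc j) `<=` \bigcup_i sq_box (p i) r.
    move=> /asboolP[i nearji] x /cell_set_cl/nearji xi.
    by exists i => //; exact: sq_box_dist.
  have H := covered_mass_le (measurable_rho tri) (rho_ge0 tri) (rho_le tri)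
    (fun i => measurable_sq_box (p i) r) (fun i => leb2_sq_box (p i) r0)
    (ler0n _ m) mC disj near_sub massE.
  exact: H.
pose s := 1 / (4 * N).
have s0 : 0 < s by rewrite divr_gt0// mulr_gt0.
have cost_ge := plan_cost_ge (mu := leb2 (R:=R)) (rho_le tri)
  (fun i => measurable_sq_box (p i) s) (fun i => leb2_sq_box (p i) s0)
  (ler0n _ m) (ltW s0) mf f0 mg g0 fw frho (fun i x => @dist_sq_boxC R (p i) s x).
(* Both sides are the total mass of the given coupling [nu]. *)
have Mw : \sum_j M j = \sum_i w i.
  have [_ nuw nuM] := coup.
  rewrite (eq_bigr _ (fun j _ => esym (nuM j))) exchange_big/=.
  by apply: eq_bigr => i _; exact: nuw.
have [nu' coup' nu'_le] := discretize_plan (measurable_rho tri) (rho_ge0 tri)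
  mC mg g0 dd0 a0 e0 massE g_ge disj Mw mf f0 fw frho.
have spread_le := spread_cost_le (measurable_rho tri) (rho_ge0 tri)
  mC mg g0 dd0 a0 e0 massE g_le coup.
have := nu_opt _ coup'; rewrite /disc_cost => nu_nu'.
have cost0 : (0 <= plan_cost p tau_opt)%E.
  apply: sume_ge0 => i _; apply: integralE_ge0 => x.
  by rewrite mulr_ge0// dist_ge0.
rewrite -/(plan_cost p tau_opt) in cost_ge nu'_le.
(* An infinite optimal cost makes the right side infinite, the factor being positive. *)
case: (plan_cost p tau_opt) cost0 cost_ge nu'_le => [c _|_ _ _|//]; last first.
  have pos : 0 < 1 + 9 * delta by lra.
  by rewrite gt0_muley ?leey ?lte_fin.
rewrite -!EFinM -!EFinD !lee_fin w1 mulr1 => cost_ge nu'_le.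
apply: (le_trans spread_le); rewrite lee_fin.
apply: approximation_ratio d0 d4 N0 EN _ (lexx _) nu_nu' nu'_le.
(* The choice [s = 1 / (4 * N)] leaves at most a quarter of the unit mass in the boxes, hence a cost
   of at least [s - s / 4]. *)
have : s * (m%:R * (n%:R * (4 * s ^+ 2))) = s / 4.
  by rewrite [X in _ * X = _]mulrA N2 /s; field; exact: Nn0.
have -> : 3 / (16 * N) = 3 / 4 * s by rewrite /s; field; exact: Nn0.
by lra.
Qed.
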